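(* Let $\lambda$ be a strict partition. Then $$\widetilde{\mathcal S}_\lambda=\sum_{\alpha}(-1)^{\ell(\sigma_\alpha)}\,\widetilde{Q}_\alpha,$$ where the sum is over all peak compositions $\alpha$ with $\lambda(\alpha)=\lambda$, and $\sigma_\alpha$ is the unique minimal permutation in $\mathfrak{S}_{\ell(\lambda)}$ such that $\sigma_\alpha\cdot\alpha=\lambda(\alpha)$.
   Context: A composition $\alpha=(\alpha_1,\dots,\alpha_k)$ of $n$ is a finite list of positive integers with sum $n$; $\ell(\alpha)=k$. $\lambda(\alpha)$ is the partition obtained by sorting the parts of $\alpha$ into weakly decreasing order. A strict partition is a partition with distinct parts. Permutations in $\mathfrak{S}_{k}$ act on compositions of length $k$ by permuting the parts; $\ell(\sigma)$ is the Coxeter length (number of inversions) of a permutation $\sigma$. The diagram $D(\alpha)$ is the left-justified array with $\alpha_i$ boxes in row $i$, rows numbered from bottom to top; box $(i,j)$ lies in column $i$ and row $j$, and $T_{i,j}$ is the entry of $T$ there. A peak composition is a composition all of whose parts, except possibly the last, are greater than $1$. A filling of $D(\alpha)$ with $1,\dots,n$ satisfies the peak-tableau condition if for every $1\le k\le n$ the boxes with entries $\le k$ form the diagram of a peak composition. SPIT: for a peak composition $\alpha$, $\mathrm{SPIT}(\alpha)$ is the set of fillings of $D(\alpha)$ with $1,\dots,n$ (each once), rows increasing from left to right, first column increasing from bottom to top, satisfying the peak-tableau condition. SYCT: a standard Young composition tableau of shape $\alpha$ is a filling of $D(\alpha)$ with $1,\dots,n$ (each once), rows increasing from left to right, first column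 increasing from bottom to top, such that whenever $i<j$, $(k,j),(k+1,i)\in D(\alpha)$ and $T_{k,j}\le T_{k+1,i}$, then $(k+1,j)\in D(\alpha)$ and $T_{k+1,j}<T_{k+1,i}$. SPYCT: for a peak composition $\alpha$, $\mathrm{SPYCT}(\alpha)$ is the set of SYCTs of shape $\alpha$ satisfying the peak-tableau condition. Readings: $\mathrm{w}_{\rm c}(T)$ reads column by column starting from the leftmost column, each from bottom to top. $\mathrm{w}_{\rm Y}(T)$ reads the first column from top to bottom, then the subsequent columns from left to right, each from bottom to top. $\mathrm{Des}(\sigma)=\{i\in[n-1]\mid i$ is to the right of $i+1$ in $\sigma\}$; $\mathrm{Peak}(X)=\{i\in X\mid i>1,\ i-1\notin X\}$. For a composition $\gamma$ of $n$, $\mathrm{set}(\gamma)=\{\gamma_1,\gamma_1+\gamma_2,\dots,\gamma_1+\cdots+\gamma_{\ell(\gamma)-1}\}$; for $I=\{i_1<\cdots<i_p\}\subseteq[n-1]$, $\mathrm{comp}(I)=(i_1,i_2-i_1,\dots,n-i_p)$. $F_\gamma=\sum x_{i_1}\cdots x_{i_n}$ over $1\le i_1\le\cdots\le i_n$ with $i_j<i_{j+1}$ if $j\in\mathrm{set}(\gamma)$. For a peak composition $\gamma$ of $n$ with $I=\mathrm{set}(\gamma)$, $K_\gamma=2^{|I|+1}\sum F_\beta$ over compositions $\beta$ of $n$ with $I\subseteq\mathrm{set}(\beta)\triangle(\mathrm{set}(\beta)+1)$ ($\triangle$ symmetric difference, $\mathrm{set}(\beta)+1=\{i+1\mid i\in\mathrm{set}(\beta)\}$).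 Quasisymmetric Schur $Q$-function: $\widetilde{Q}_\alpha=\sum_{T\in\mathrm{SPIT}(\alpha)}K_{\mathrm{comp}(\mathrm{Peak}(\mathrm{Des}(\mathrm{w}_{\rm c}(T))))}$. Peak Young quasisymmetric Schur function: $\widetilde{\mathcal S}_\alpha=\sum_{T\in\mathrm{SPYCT}(\alpha)}K_{\mathrm{comp}(\mathrm{Peak}(\mathrm{Des}(\mathrm{w}_{\rm Y}(T))))}$. *)

(* Defs.v *)
(* Rows, columns and tableau entries are numbered from 1, as in the usual
   combinatorial conventions, while [nth] counts from 0; hence the
   predecessors [.-1] below. *)
From HB Require Import structures.
From mathcomp Require Import all_boot all_order all_fingroup all_algebra.
From mathcomp Require Import finmap multiset.

Set Implicit Arguments.
Unset Strict Implicit.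
Unset Printing Implicit Defensive.

Import GRing.Theory.

Definition is_comp (n : nat) (c : seq nat) : bool :=
  all (leq 1) c && (sumn c == n).

Record composition (n : nat) : Type :=
  Composition { comp_val :> seq nat; comp_valP : is_comp n comp_val }.

HB.instance Definition _ n := [isSub for @comp_val n].
HB.instance Definition _ n := [Countable of composition n by <:].

Lemma mem_sumn_leq (c : seq nat) x : x \in c -> x <= sumn c.
Proof.
elim: c => //= y c IHc; rewrite inE => /orP[/eqP->|/IHc xc]; first exact: leq_addr.
exact: leq_trans xc (leq_addl _ _).
Qed.

Lemma size_leq_sumn (c : seq nat) : all (leq 1) c -> size c <= sumn c.
Proof.
elim: c => //= y c IHc /andP[y1 /IHc szc].
by rewrite -addn1 addnC leq_add.
Qed.

(* A composition of n has at most n parts, each at most n. *)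
Definition composition_enum (n : nat) : seq (composition n) :=
  undup (pmap insub [seq map val (b : seq 'I_n.+1) | b : n.-bseq 'I_n.+1]).

Lemma composition_enumP n : Finite.axiom (composition_enum n).
Proof.
apply: Finite.uniq_enumP; first exact: undup_uniq.
move=> c; rewrite mem_undup mem_pmap.
apply/mapP; exists (val c); last by rewrite valK.
have /andP[c1 /eqP cn] := valP c.
have szc : size (map (@inord n) (val c)) <= n.
  by rewrite size_map -[X in _ <= X]cn size_leq_sumn.
apply/imageP; exists (Bseq szc) => //=.
rewrite -map_comp -[LHS]map_id; apply/eq_in_map => x xc /=.
by rewrite inordK // ltnS -cn mem_sumn_leq.
Qed.

HB.instance Definition _ n := isFinite.Build (composition n) (@composition_enumP n).

Definition is_peak (c : seq nat) : bool :=
  all (leq 1) c && all (leq 2) (take (size c).-1 c).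

Definition strict_partition (lam : seq nat) : bool :=
  all (leq 1) lam && sorted gtn lam.

Definition part_of (c : seq nat) : seq nat := sort geq c.

Definition comp_set (c : seq nat) : seq nat :=
  [seq sumn (take i c) | i <- iota 1 (size c).-1].

(* [I] lists a subset of [n-1] in increasing order; the only composition of 0
   is the empty one. *)
Definition comp_of (n : nat) (I : seq nat) : seq nat :=
  if n is 0 then [::] else pairmap (fun a b => b - a) 0 (rcons I n).

(* Left action: (s . c)_(s i) = c_i. *)
Definition act_comp (k : nat) (s : 'S_k) (c : seq nat) : seq nat :=
  [seq nth 0 c (s^-1%g j) | j <- enum 'I_k].

Definition perm_length (k : nat) (s : 'S_k) : nat :=
  #|[set p : 'I_k * 'I_k | (p.1 < p.2) && (s p.2 < s p.1)]|.

(* The default 1 is never used as such: see [sort_permP]. *)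
Definition sort_perm (c : seq nat) : 'S_(size c) :=
  [arg min_(s < 1%g | act_comp s c == part_of c) perm_length s].

Lemma sort_perm_exists (c : seq nat) :
  exists s : 'S_(size c), act_comp s c = part_of c.
Proof.
have /tuple_permP[s def_s] : perm_eq (part_of c) (in_tuple c).
  by rewrite perm_sort.
exists s^-1%g; rewrite def_s /act_comp invgK /=.
by apply: eq_map => j; rewrite (tnth_nth 0).
Qed.

Lemma sort_permP (c : seq nat) :
  act_comp (sort_perm c) c = part_of c /\
  (forall s : 'S_(size c),
     act_comp s c = part_of c -> perm_length (sort_perm c) <= perm_length s).
Proof.
have [s0 /eqP s0P] := sort_perm_exists c.
rewrite /sort_perm /arg_min /extremum; case: pickP => [s /andP[/eqP sP]|none] /=.
  by move=> /forallP min_s; split=> // t /eqP tP; have /implyP := min_s t; apply.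
have [s sP min_s] := @arg_minnP _ s0 (fun s => act_comp s c == part_of c)
  (@perm_length _) s0P.
have /negP[] := negbT (none s); rewrite /= sP; apply/forallP=> t.
by apply/implyP=> tP; exact: min_s.
Qed.

(* The box (i, j) lies in column i and row j; rows go from bottom to top. *)
Definition diagram (c : seq nat) : seq (nat * nat) :=
  [seq (i, j) | j <- iota 1 (size c), i <- iota 1 (nth 0 c j.-1)].

(* A tableau is the list of its rows, from bottom to top. *)
Definition tableau := seq (seq nat).

Definition entry (T : tableau) (i j : nat) : nat := nth 0 (nth [::] T j.-1) i.-1.

Definition fillings (c : seq nat) : seq tableau :=
  [seq reshape c s | s <- permutations (iota 1 (sumn c))].

Lemma fillings_uniq c : uniq (fillings c).
Proof.
rewrite map_inj_in_uniq ?permutations_uniq // => s t.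
rewrite !mem_permutations => /perm_size ss /perm_size st.
by move/(congr1 flatten); rewrite !reshapeKr // ?ss ?st size_iota.
Qed.

Lemma mem_fillings c T :
  (T \in fillings c) =
  (shape T == c) && perm_eq (flatten T) (iota 1 (sumn c)).
Proof.
apply/mapP/andP => [[s]|[/eqP <- pT]].
  rewrite mem_permutations => ps -> {T}.
  have sz := perm_size ps; rewrite size_iota in sz.
  by rewrite reshapeKl ?reshapeKr ?sz.
by exists (flatten T); rewrite ?flattenK // mem_permutations.
Qed.

Definition tab_col (T : tableau) (i : nat) : seq nat :=
  [seq entry T i j | j <- iota 1 (size T) & (i, j) \in diagram (shape T)].

Definition ncols (T : tableau) : nat := \max_(r <- shape T) r.

Definition rows_increasing (T : tableau) : bool := all (sorted ltn) T.

Definition first_col_increasing (T : tableau) : bool := sorted ltn (tab_col T 1).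

Definition boxes_le (T : tableau) (k : nat) : seq (nat * nat) :=
  [seq b <- diagram (shape T) | entry T b.1 b.2 <= k].

(* In a filling by 1, ..., n exactly k boxes have entry at most k, so the peak
   composition they form is a composition of k. *)
Definition peak_tableau (T : tableau) : bool :=
  all (fun k => [exists b : composition k,
                   is_peak b && perm_eq (boxes_le T k) (diagram b)])
      (iota 1 (sumn (shape T))).

(* A row has at most [sumn (shape T)] boxes, so the ranges of i, j, k lose
   nothing. *)
Definition young_triple (T : tableau) : bool :=
  let D := diagram (shape T) in
  [forall i : 'I_(size T).+1, forall j : 'I_(size T).+1,
   forall k : 'I_(sumn (shape T)).+1,
     [&& i < j, (val k, val j) \in D, (k.+1, val i) \in D
       & entry T k j <= entry T k.+1 i] ==>
     ((k.+1, val j) \in D) && (entry T k.+1 j < entry T k.+1 i)].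

Definition SPIT (c : seq nat) : seq tableau :=
  [seq T <- fillings c |
    [&& rows_increasing T, first_col_increasing T & peak_tableau T]].

Definition SYCT (c : seq nat) : seq tableau :=
  [seq T <- fillings c |
    [&& rows_increasing T, first_col_increasing T & young_triple T]].

Definition SPYCT (c : seq nat) : seq tableau :=
  [seq T <- SYCT c | peak_tableau T].

Definition word_c (T : tableau) : seq nat :=
  flatten [seq tab_col T i | i <- iota 1 (ncols T)].

Definition word_Y (T : tableau) : seq nat :=
  rev (tab_col T 1) ++ flatten [seq tab_col T i | i <- iota 2 (ncols T).-1].

(* Subsets of [n-1] are listed in increasing order. *)
Definition Des (w : seq nat) : seq nat :=
  [seq i <- iota 1 (size w).-1 | index i.+1 w < index i w].

Definition Peak (X : seq nat) : seq nat :=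
  [seq i <- X | (1 < i) && (i.-1 \notin X)].

(* The monomial x_(i_1) ... x_(i_n) is the multiset {i_1, ..., i_n}, and a
   power series is its coefficient function (x_0 never occurs). *)
Definition monomial := {mset nat}%mset.
Definition power_series := monomial -> int.

Definition F_index (c s : seq nat) : bool :=
  [&& size s == sumn c, all (leq 1) s, sorted leq s
    & all (fun j => nth 0 s j.-1 < nth 0 s j) (comp_set c)].

(* The index sequences s with x_(s_1) ... x_(s_n) = m are the arrangements
   of m. *)
Definition fund_F (c : seq nat) : power_series :=
  fun m => (count (F_index c) (permutations (enum_mset m)))%:Z%R.

Definition K_index (c b : seq nat) : bool :=
  all (fun i => (i \in comp_set b) (+) (i \in [seq j.+1 | j <- comp_set b]))
      (comp_set c).

Definition peak_K (c : seq nat) : power_series :=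
  fun m => (2 ^+ (size (comp_set c)).+1 *
            \sum_(b : composition (sumn c) | K_index c b) fund_F b m)%R.

Definition quasisym_schurQ (c : seq nat) : power_series :=
  fun m => (\sum_(T <- SPIT c)
              peak_K (comp_of (sumn c) (Peak (Des (word_c T)))) m)%R.

Definition peak_young_quasisym_schur (c : seq nat) : power_series :=
  fun m => (\sum_(T <- SPYCT c)
              peak_K (comp_of (sumn c) (Peak (Des (word_Y T)))) m)%R.

(* Main.v *)
(* In a peak tableau x and x + 1 never both lie in the first column, so w_c and
   w_Y have the same descents. A tableau in SPIT records a growing sequence of
   peak compositions; call the time m a tie if two rows contain the same positive
   number of entries <= m. At the last tie m, exchanging the entries > m of the
   two tied rows is an involution: it transposes two parts of the shape,
   reversing the sign, and it keeps the descents, because two consecutive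
   entries x, x + 1 in the same column create a tie at x + 1. The tableaux
   without ties all have the shape lam, and they are those in SPYCT(lam). *)

Require Import Defs.
From mathcomp Require Import all_boot all_order all_fingroup all_algebra.
From mathcomp Require Import finmap multiset.
From mathcomp Require Import zify.

Set Implicit Arguments.
Unset Strict Implicit.
Unset Printing Implicit Defensive.

Import GRing.Theory Num.Theory.

(** * Row counts *)

(** In an increasing list the entries at most [m] form an initial segment, so an index lies inside
    it exactly when it is below its length. *)
Lemma ltn_count_leq (s : seq nat) m i :
  sorted ltn s -> i < size s ->
  (i < count (leq^~ m) s) = (nth 0 s i <= m).
Proof.
elim: s i => //= x s IHs i; rewrite (path_sortedE ltn_trans) => /andP[xs s_inc].
have count0 : m < x -> count (leq^~ m) s = 0.
  move=> mx; apply/eqP; rewrite -leqn0 leqNgt -has_count; apply/hasPn => y ys /=.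
  by rewrite -ltnNge (ltn_trans mx) // (allP xs).
case: i => [|i] /= i_lt.
  by case: (leqP x m) => [_|/count0->].
case: (leqP x m) => [_|mx]; first by rewrite add1n ltnS IHs.
rewrite count0 //=; apply/esym/negbTE; rewrite -ltnNge (ltn_trans mx) //.
by rewrite (allP xs) ?mem_nth.
Qed.

Lemma filter_split_sorted (s : seq nat) m :
  sorted ltn s -> filter (leq^~ m) s ++ filter (ltn m) s = s.
Proof.
elim: s => //= x s IHs; rewrite (path_sortedE ltn_trans) => /andP[xs s_inc].
case: leqP => [_|mx] /=; first by rewrite IHs.
rewrite -{3}(IHs s_inc) (_ : filter (leq^~ m) s = [::]) //.
apply/eqP; rewrite -(negbK (_ == _)) -has_filter; apply/hasPn => y ys /=.
by rewrite -ltnNge (ltn_trans mx) // (allP xs).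
Qed.

(** Rows are numbered from 0 here but from 1 in [entry] and [diagram], whence the [r.+1] below. For
    growing [m] the row counts give the chain of shapes that the tableau records. *)
Definition row_count (T : tableau) (m r : nat) : nat :=
  count (leq^~ m) (nth [::] T r).

Lemma row_count_mono T r : {homo (row_count T)^~ r : m m' / m <= m'}.
Proof. by move=> m m' mm'; apply: sub_count => x /= /leq_trans; apply. Qed.

Lemma row_count_le_size T m r : row_count T m r <= nth 0 (shape T) r.
Proof.
rewrite /row_count; have [rT|rT] := ltnP r (size T).
  by rewrite (nth_map [::]) // count_size.
by rewrite nth_default.
Qed.

Lemma row_count_gt0_lt T m r : 0 < row_count T m r -> r < size T.
Proof. by case: (ltnP r (size T)) => // rT; rewrite /row_count nth_default. Qed.

Definition standard (T : tableau) : bool :=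
  perm_eq (flatten T) (iota 1 (sumn (shape T))).

(* In terms of [row_count], the peak-tableau condition says that a row is
   only started once the row below it has two boxes. *)
Record peak_growth (T : tableau) : Prop := PeakGrowth {
  rows_nonempty : all (leq 1) (shape T);
  rows_sorted : all (sorted ltn) T;
  entries_standard : standard T;
  row_start : forall m r, 0 < row_count T m r.+1 -> 1 < row_count T m r }.

Lemma nth_row_sorted (T : tableau) r : all (sorted ltn) T -> sorted ltn (nth [::] T r).
Proof.
by move=> /allP Ts; case: (ltnP r (size T)) => rT;
   [apply: Ts; rewrite mem_nth | rewrite nth_default].
Qed.

Lemma nth_shape (T : tableau) r : nth 0 (shape T) r = size (nth [::] T r).
Proof.
case: (ltnP r (size T)) => rT; first by rewrite (nth_map [::]).
by rewrite [in RHS]nth_default // nth_default ?size_map.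
Qed.

Lemma mem_diagram c i j :
  ((i, j) \in diagram c) = (0 < j) && (0 < i <= nth 0 c j.-1).
Proof.
apply/allpairsPdep/idP => [[j' [i' [+ + [-> ->]]]]|].
  by rewrite !mem_iota add1n => /andP[-> _]; lia.
case/and3P=> j0 i0 ic; exists j, i; rewrite !mem_iota; split=> //.
  by move: ic; case: (leqP j (size c)) => [|cj]; [|rewrite nth_default]; lia.
by rewrite i0 add1n ltnS.
Qed.

Lemma diagram_uniq c : uniq (diagram c).
Proof.
apply: allpairs_uniq_dep => [|j _|]; try exact: iota_uniq.
by move=> [j i] [j' i'] _ _ /= [-> ->].
Qed.

(** The dictionary between row counts and entries: rows increase, so the box in column [i] is filled
    by time [m] once its row holds [i] entries at most [m]. *)
Lemma row_countP (T : tableau) m i r :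
  all (sorted ltn) T -> (i, r.+1) \in diagram (shape T) ->
  (i <= row_count T m r) = (entry T i r.+1 <= m).
Proof.
rewrite mem_diagram /= nth_shape => Ts /andP[i0 ir].
by rewrite /entry /= -ltn_count_leq ?nth_row_sorted ?prednK //; lia.
Qed.

Lemma row_countW T m i r :
  0 < i -> i <= row_count T m r -> (i, r.+1) \in diagram (shape T).
Proof.
by move=> i0 ir; rewrite mem_diagram /= i0 (leq_trans ir) ?row_count_le_size.
Qed.

Lemma map_nth_iota1 (S : Type) (x0 : S) (s : seq S) :
  [seq nth x0 s j.-1 | j <- iota 1 (size s)] = s.
Proof.
apply: (@eq_from_nth _ x0); rewrite size_map size_iota // => j j_lt.
by rewrite (nth_map 0) ?size_iota // nth_iota.
Qed.

(** [diagram] lists the boxes row by row, as [flatten] does the entries, so properties of the list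
    of entries transfer to boxes. *)
Lemma map_entry_diagram (T : tableau) :
  [seq entry T b.1 b.2 | b <- diagram (shape T)] = flatten T.
Proof.
rewrite map_allpairs /= size_map -[in RHS](map_nth_iota1 [::] T); congr flatten.
by apply: eq_map => j; rewrite nth_shape -[RHS](map_nth_iota1 0).
Qed.

Lemma entries_uniq T : standard T -> uniq (flatten T).
Proof. by move/perm_uniq->; rewrite iota_uniq. Qed.

Lemma entry_inj T : standard T ->
  {in diagram (shape T) &, injective (fun b => entry T b.1 b.2)}.
Proof.
move=> /entries_uniq; rewrite -map_entry_diagram.
move=> uT b b' /(nthP (0, 0))[i i_lt <-] /(nthP (0, 0))[j j_lt <-] /eqP.
rewrite -!(nth_map _ 0 (fun b => entry T b.1 b.2)) //.
by rewrite nth_uniq ?size_map // => /eqP->.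
Qed.

Lemma entry_range T b : standard T -> b \in diagram (shape T) ->
  0 < entry T b.1 b.2 <= sumn (shape T).
Proof.
move=> /perm_mem pT bT.
have := pT (entry T b.1 b.2); rewrite mem_iota add1n ltnS => <-.
by rewrite -map_entry_diagram; apply/mapP; exists b.
Qed.

Lemma entry_box T x : standard T -> 0 < x <= sumn (shape T) ->
  exists2 b, b \in diagram (shape T) & entry T b.1 b.2 = x.
Proof.
move=> /perm_mem pT xT.
have := pT x; rewrite mem_iota add1n ltnS xT -map_entry_diagram => /mapP[b bT ->].
by exists b.
Qed.

Lemma count_standard T m : standard T -> m <= sumn (shape T) ->
  count (leq^~ m) (flatten T) = m.
Proof.
move=> /seq.permP-> mT.
have count_below : count (leq^~ m) (iota 1 m) = size (iota 1 m).
  by apply/eqP; rewrite -all_count; apply/allP => y; rewrite mem_iota /=; lia.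
have count_above : count (leq^~ m) (iota (1 + m) (sumn (shape T) - m)) = 0.
  apply/eqP; rewrite -leqn0 leqNgt -has_count; apply/hasPn => y.
  by rewrite mem_iota /= -ltnNge; lia.
by rewrite -{1}(subnKC mT) iotaD count_cat count_below count_above addn0 size_iota.
Qed.

Lemma count_flatten_row_count T m :
  count (leq^~ m) (flatten T) = sumn [seq row_count T m r | r <- iota 0 (size T)].
Proof.
rewrite count_flatten; congr sumn.
apply: (@eq_from_nth _ 0); rewrite !size_map ?size_iota // => r rT.
by rewrite !(nth_map 0) ?(nth_map [::]) ?size_iota // nth_iota.
Qed.

(** At the final time every entry has been placed; facts on row counts thus specialise to facts on
    the shape. *)
Lemma row_count_size T r : standard T ->
  row_count T (sumn (shape T)) r = nth 0 (shape T) r.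
Proof.
move=> pT; rewrite nth_shape; apply/eqP; rewrite -all_count; apply/allP => x xr /=.
have [rT|rT] := ltnP r (size T); last by rewrite nth_default in xr.
have : x \in flatten T by apply/flattenP; exists (nth [::] T r); rewrite ?mem_nth.
by rewrite (perm_mem pT) mem_iota; lia.
Qed.

Lemma row_start_lt T r r' m : peak_growth T -> r < r' ->
  0 < row_count T m r' -> 1 < row_count T m r.
Proof.
move=> gT; elim: r' => // r' IHr'; rewrite ltnS leq_eqVlt => /orP[/eqP<-|rr'].
  exact: row_start.
by move/(row_start gT)/ltnW/(IHr' rr').
Qed.

Lemma peak_growth_is_peak T : peak_growth T -> is_peak (shape T).
Proof.
move=> gT; rewrite /is_peak rows_nonempty //=; apply/(all_nthP 0) => r.
rewrite size_take_min => rT; have {}rT : r.+1 < size (shape T) by move: rT; lia.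
rewrite nth_take; last by lia.
rewrite -row_count_size ?entries_standard // row_start //.
rewrite row_count_size ?entries_standard //.
by apply: (all_nthP 0 (rows_nonempty gT)).
Qed.

Lemma tab_col1 T : all (leq 1) (shape T) ->
  tab_col T 1 = [seq entry T 1 j | j <- iota 1 (size T)].
Proof.
move=> T1; rewrite /tab_col (_ : filter _ _ = iota 1 (size T)) //.
apply/all_filterP/allP => j; rewrite mem_iota mem_diagram => /andP[j0 jT] /=.
rewrite j0; apply: (all_nthP 0 T1); rewrite size_map.
by lia.
Qed.

Lemma mem_boxes_le T m i r : all (sorted ltn) T ->
  ((i, r.+1) \in boxes_le T m) = (0 < i <= row_count T m r).
Proof.
move=> Ts; rewrite mem_filter /=; apply/andP/andP => [[im iT]|[i0 ir]].
  by rewrite row_countP // im; move: iT; rewrite mem_diagram /= => /andP[].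
have iT := row_countW i0 ir.
by rewrite iT -row_countP.
Qed.

(** The peak condition is applied at the time when row [r.+1] receives its first box: row [r] is
    then not the last part, so it has two boxes, and it keeps them at all later times. *)
Lemma SPIT_peak_growth c T : is_peak c -> T \in SPIT c -> peak_growth T.
Proof.
move=> /andP[c1 c2]; rewrite mem_filter mem_fillings => /andP[/and3P[Ts _ pkT]].
case/andP=> /eqP shT pT; rewrite -shT in pT c1 c2.
split=> // m r r1.
have b1 : (1, r.+2) \in diagram (shape T) by exact: row_countW r1.
have /andP[x0 xT] := entry_range pT b1.
have /allP/(_ (entry T 1 r.+2)) := pkT; rewrite mem_iota add1n ltnS x0 xT.
case/(_ isT)/existsP=> b /andP[/andP[b1s b2s] /perm_mem pb].
have := pb (1, r.+2); rewrite mem_boxes_le // row_countP // mem_diagram /= leqnn => rb.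
have : (2, r.+1) \in boxes_le T (entry T 1 r.+2).
  rewrite pb mem_diagram /=.
  have rsz : r.+1 < size b.
    by rewrite ltnNge; apply/negP=> sb; rewrite nth_default in rb.
  have /(all_nthP 0)/(_ r) := b2s; rewrite size_take_min nth_take; last by lia.
  by apply; lia.
rewrite mem_boxes_le //= => /leq_trans; apply; apply: row_count_mono.
by rewrite -row_countP.
Qed.

Lemma peak_growth_SPIT T : peak_growth T -> T \in SPIT (shape T).
Proof.
move=> gT; have [T1 Ts pT _] := gT.
rewrite mem_filter mem_fillings eqxx (pT : perm_eq _ _) !andbT.
apply/and3P; split=> //.
  (* The second box of row [r] is filled no later than the first box of row [r.+1], and the first
     box of row [r] comes before both. *)
  rewrite /first_col_increasing tab_col1 //; apply/(sortedP 0) => r.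
  rewrite size_map size_iota => rT; have rT' := ltnW rT.
  rewrite !(nth_map 0) ?size_iota // !nth_iota // !add1n.
  have b1 : (1, r.+2) \in diagram (shape T).
    by rewrite mem_diagram /=; apply: (all_nthP 0 T1); rewrite size_map.
  have b2 : 1 < row_count T (entry T 1 r.+2) r by apply: row_start; rewrite ?row_countP.
  have D2 : (2, r.+1) \in diagram (shape T) by apply: row_countW b2.
  move: b2; rewrite row_countP //; apply: leq_trans.
  have /sortedP : sorted ltn (nth [::] T r) by apply: nth_row_sorted.
  by move=> /(_ 0 0); apply; move: D2; rewrite mem_diagram nth_shape /=.
apply/allP => m; rewrite mem_iota add1n ltnS => /andP[m0 mT].
pose cs := [seq row_count T m r | r <- iota 0 (size T)].
have nth_cs r : nth 0 cs r = row_count T m r.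
  have [rT|rT] := ltnP r (size T); last first.
    by rewrite nth_default ?size_map ?size_iota // /row_count nth_default.
  by rewrite (nth_map 0) ?size_iota // nth_iota.
(* The row counts are cut at the first row [h] that is empty at time [m] (or at the number of rows).
   By [row_start_lt] a nonempty row above [h] would force boxes in row [h], so only zeros are
   dropped. *)
pose h := find (pred1 0) cs; pose b := take h cs.
have b_gt0 r : r < h -> 0 < nth 0 cs r.
  by move/(before_find 0)/negbT => /=; rewrite lt0n.
have b_out r : h <= r -> nth 0 cs r = 0.
  move=> hr; have [rs|rs] := ltnP r (size cs); last by rewrite nth_default.
  have h0 : nth 0 cs h = 0.
    by apply/eqP/(nth_find 0 (a := pred1 0)); rewrite has_find (leq_ltn_trans hr).
  apply/eqP; rewrite -leqn0 leqNgt; apply/negP; rewrite nth_cs => r0.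
  move: hr; rewrite leq_eqVlt => /orP[/eqP hr|/row_start_lt/(_ r0)].
    by rewrite -nth_cs -hr h0 in r0.
  by move=> /(_ gT); rewrite -nth_cs h0.
have nth_b r : nth 0 b r = nth 0 cs r.
  have [rh|rh] := ltnP r h; first by rewrite nth_take.
  by rewrite b_out // nth_default // size_take_min geq_min rh.
have szb : size b = h by rewrite size_takel // find_size.
have sumb : sumn b = m.
  rewrite -(count_standard pT mT) count_flatten_row_count -/cs.
  rewrite -[in RHS](cat_take_drop h cs) sumn_cat -/b.
  suff /all_pred1P-> : all (pred1 0) (drop h cs) by rewrite sumn_nseq addn0.
  by apply/(all_nthP 0) => r _; rewrite nth_drop /= b_out ?leq_addr.
have b1 : all (leq 1) b.
  by apply/(all_nthP 0) => r; rewrite szb nth_b; apply: b_gt0.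
have bP : is_comp m b by rewrite /is_comp b1 sumb /=.
apply/existsP; exists (Composition bP); apply/andP; split; last first.
  apply: uniq_perm; rewrite ?filter_uniq ?diagram_uniq //= => -[i [|r]].
    by rewrite mem_filter !mem_diagram andbF.
  by rewrite mem_boxes_le // mem_diagram /= nth_b nth_cs.
rewrite /is_peak /= b1; apply/(all_nthP 0) => r; rewrite size_take_min szb => rb.
rewrite nth_take; last by move: rb; lia.
rewrite nth_b nth_cs; apply: row_start => //; rewrite -nth_cs; apply: b_gt0.
by move: rb; lia.
Qed.

Lemma SPITP c T : is_peak c ->
  reflect (shape T = c /\ peak_growth T) (T \in SPIT c).
Proof.
move=> c_peak; apply: (iffP idP) => [Tc|[<-]]; last exact: peak_growth_SPIT.
split; last exact: SPIT_peak_growth Tc.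
by move: Tc; rewrite mem_filter mem_fillings => /and3P[_ /eqP].
Qed.

(** * Reading words *)

Lemma index_pairwise (S : eqType) (R : rel S) (s : seq S) x y :
  irreflexive R -> transitive R -> pairwise R s -> x \in s -> y \in s ->
  (index x s < index y s) = R x y.
Proof.
move=> Rirr Rtr Rs xs ys.
have ltR a b : a \in s -> b \in s -> index a s < index b s -> R a b.
  move=> sa sb ab; rewrite -(nth_index x sa) -(nth_index x sb).
  by move/(pairwiseP x): Rs; apply; rewrite ?inE ?index_mem.
apply/idP/idP => [|Rxy]; first exact: ltR.
rewrite ltnNge; apply/negP; rewrite leq_eqVlt => /orP[/eqP yx|/(ltR _ _ ys xs)].
  move: Rxy; rewrite -(nth_index x xs) -yx nth_index //.
  by rewrite Rirr.
by move/(Rtr _ _ _ Rxy); rewrite Rirr.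
Qed.

Definition col_lt : rel (nat * nat) :=
  fun b b' => (b.1 < b'.1) || (b.1 == b'.1) && (b.2 < b'.2).

Lemma col_lt_irr : irreflexive col_lt.
Proof. by move=> b; rewrite /col_lt !ltnn andbF. Qed.

Lemma col_lt_trans : transitive col_lt.
Proof. by move=> [a a'] [b b'] [c c']; rewrite /col_lt /=; lia. Qed.

(** The boxes in the reading order of [word_c]; relative positions in the word become [col_lt]
    comparisons of boxes ([index_word_c]). *)
Definition col_boxes (T : tableau) : seq (nat * nat) :=
  [seq (i, j) | i <- iota 1 (ncols T),
                j <- [seq j <- iota 1 (size T) | (i, j) \in diagram (shape T)]].

Lemma col_boxes_pairwise T : pairwise col_lt (col_boxes T).
Proof.
have : pairwise ltn (iota 1 (ncols T)).
  by rewrite -sorted_pairwise ?iota_ltn_sorted //; exact: ltn_trans.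
rewrite /col_boxes; elim: (iota 1 (ncols T)) => //= i s IHs /andP[i_lt s_lt].
rewrite pairwise_cat IHs // andbT; apply/andP; split.
  apply/allrelP => b b' /mapP[j _ ->] /allpairsPdep[i' [j' [i's _ ->]]].
  by have ii' : i < i' := allP i_lt _ i's; rewrite /col_lt /= ii'.
rewrite pairwise_map -sorted_pairwise; last first.
  by move=> ? ? ?; exact: col_lt_trans.
rewrite (@eq_sorted _ _ ltn) ?sorted_filter ?iota_ltn_sorted //; first exact: ltn_trans.
by move=> j j'; rewrite /col_lt /= ltnn eqxx.
Qed.

Lemma mem_col_boxes T : col_boxes T =i diagram (shape T).
Proof.
move=> [i j]; apply/allpairsPdep/idP => [[i' [j' [_ + [-> ->]]]]|ijT].
  by rewrite mem_filter => /andP[].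
exists i, j; rewrite mem_filter ijT !mem_iota; split=> //.
  move: ijT; rewrite mem_diagram => /and3P[j0 i0 ij]; rewrite i0 add1n ltnS.
  apply: leq_trans ij _; rewrite /ncols (big_nth 0) big_mkord.
  have [jT|jT] := ltnP j.-1 (size (shape T)); last by rewrite nth_default.
  by rewrite (bigmax_sup (Ordinal jT)).
move: ijT; rewrite mem_diagram; have [jT|jT] := ltnP j.-1 (size (shape T)).
  by move: jT; rewrite size_map; lia.
by rewrite nth_default //; lia.
Qed.

Lemma word_c_col_boxes T : word_c T = [seq entry T b.1 b.2 | b <- col_boxes T].
Proof. by rewrite map_allpairs. Qed.

Lemma size_word_c T : size (word_c T) = sumn (shape T).
Proof.
rewrite word_c_col_boxes size_map -size_flatten -map_entry_diagram size_map.
apply/perm_size/uniq_perm; rewrite ?diagram_uniq //; last exact: mem_col_boxes.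
exact: pairwise_uniq col_lt_irr (col_boxes_pairwise T).
Qed.

Lemma index_word_c T b b' : standard T ->
  b \in diagram (shape T) -> b' \in diagram (shape T) ->
  (index (entry T b.1 b.2) (word_c T) < index (entry T b'.1 b'.2) (word_c T)) =
  col_lt b b'.
Proof.
move=> pT; rewrite -!mem_col_boxes => bT b'T; rewrite word_c_col_boxes.
have inj := entry_inj pT.
have indexE c : c \in col_boxes T ->
  index (entry T c.1 c.2) [seq entry T b.1 b.2 | b <- col_boxes T] =
  index c (col_boxes T).
  move=> cT; have uT := pairwise_uniq col_lt_irr (col_boxes_pairwise T).
  rewrite -[in LHS](nth_index c cT).
  rewrite -(nth_map c 0 (fun b => entry T b.1 b.2)) ?index_mem //.
  rewrite index_uniq ?size_map ?index_mem // map_inj_in_uniq //.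
  by move=> d d' dT d'T; apply: inj; rewrite -mem_col_boxes.
rewrite !indexE //.
exact: (index_pairwise col_lt_irr col_lt_trans (col_boxes_pairwise T)).
Qed.

Lemma mem_tab_col T i x :
  reflect (exists2 j, (i, j) \in diagram (shape T) & entry T i j = x)
          (x \in tab_col T i).
Proof.
apply: (iffP mapP) => [[j]|[j ijT <-]].
  by rewrite mem_filter => /andP[ijT _] ->; exists j.
exists j => //; rewrite mem_filter ijT mem_iota.
move: ijT; rewrite -mem_col_boxes => /allpairsPdep[? [? [_ + [_ ->]]]].
by rewrite mem_filter mem_iota => /andP[].
Qed.

Lemma word_c_cons T :
  word_c T = tab_col T 1 ++ flatten [seq tab_col T i | i <- iota 2 (ncols T).-1].
Proof.
rewrite /word_c; case nT: (ncols T) => [|n] //=; rewrite cats0.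
(* Only the tableau without columns is left; its first column is empty because there is no box. *)
case E: (tab_col T 1) => [|x s] //; have : x \in tab_col T 1 by rewrite E mem_head.
by case/mem_tab_col=> j; rewrite -mem_col_boxes /col_boxes nT.
Qed.

(* A new row is started only after the previous one has received its second
   box, so the first column never contains two consecutive entries. *)
Lemma col1_not_consecutive T x : peak_growth T ->
  x \in tab_col T 1 -> x.+1 \in tab_col T 1 -> False.
Proof.
move=> gT /mem_tab_col[j jT xj] /mem_tab_col[j' j'T xj'].
have [_ Ts pT _] := gT.
case: j jT xj => [|r]; first by rewrite mem_diagram.
case: j' j'T xj' => [|r']; first by rewrite mem_diagram.
move=> r'T xr' rT xr.
have two s s' : s < s' -> (1, s'.+1) \in diagram (shape T) ->
  (2, s.+1) \in diagram (shape T) /\ entry T 2 s.+1 <= entry T 1 s'.+1.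
  move=> ss' s'T; have /(row_start_lt gT ss') s2 : 0 < row_count T (entry T 1 s'.+1) s'.
    by rewrite row_countP.
  by split; [apply: row_countW s2 | rewrite -row_countP //; apply: row_countW s2].
have incr s : (2, s.+1) \in diagram (shape T) -> entry T 1 s.+1 < entry T 2 s.+1.
  rewrite mem_diagram nth_shape /= => s2.
  by have /(sortedP 0)/(_ 0 s2) := nth_row_sorted s Ts.
(* If [x.+1] starts the higher row, the second entry of the lower row exceeds [x] and is at most
   [x.+1], so it repeats [x.+1]. If [x.+1] starts the lower row, the second entry of that row would
   exceed [x.+1] and be at most [x]. *)
case: (ltngtP r r') => [rr'|r'r|rr'].
- have [r2 r2x] := two _ _ rr' r'T; have r1x := incr _ r2.
  have e : entry T 2 r.+1 = entry T 1 r'.+1 by lia.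
  by have := entry_inj pT r2 r'T e.
- have [r'2] := two _ _ r'r rT; have := incr _ r'2; rewrite xr xr'; lia.
- by move: xr'; rewrite -rr' xr; lia.
Qed.

(** Reversing the first column affects the relative order of [x] and [x.+1] only if both lie in it,
    which [col1_not_consecutive] excludes. *)
Lemma Des_word_Y T : peak_growth T -> Des (word_Y T) = Des (word_c T).
Proof.
move=> gT; rewrite word_c_cons /word_Y /Des !size_cat size_rev.
apply: eq_filter => x; rewrite !index_cat !mem_rev size_rev.
have := @col1_not_consecutive T x gT.
have lt_size (s : seq nat) y : y \in s -> index y (rev s) < size s /\ index y s < size s.
  by move=> ys; rewrite index_mem ys -(size_rev s) index_mem mem_rev.
case: ifP => x's; case: ifP => xs col1 //; first by case: (col1 isT isT).
  by have [? ?] := lt_size _ _ x's; rewrite !ltn_addr.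
have [ix ix'] := lt_size _ _ xs.
by rewrite !ltnNge (ltnW (ltn_addr _ ix)) (ltnW (ltn_addr _ ix')).
Qed.

(** * Exchanging two rows *)

Definition transp (i j r : nat) : nat :=
  if r == i then j else if r == j then i else r.

Lemma transpK i j : involutive (transp i j).
Proof. by move=> r; rewrite /transp; do 4?case: eqP => //=; lia. Qed.

Definition tied (T : tableau) (m : nat) (p : nat * nat) : bool :=
  [&& p.1 < p.2, 0 < row_count T m p.1 & row_count T m p.1 == row_count T m p.2].

(** When the rows of [p] tie at [m], their tails of entries above [m] start in the same column, so
    every entry keeps its column. *)
Definition exchange (T : tableau) (m : nat) (p : nat * nat) : tableau :=
  mkseq (fun r => filter (leq^~ m) (nth [::] T r) ++
                  filter (ltn m) (nth [::] T (transp p.1 p.2 r))) (size T).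

Section Exchange.

Variables (T : tableau) (m : nat) (p : nat * nat).
Hypotheses (gT : peak_growth T) (tied_p : tied T m p).

Let tau := transp p.1 p.2.
Let T' := exchange T m p.

Lemma transp_lt_size r : (tau r < size T) = (r < size T).
Proof.
have /and3P[p12 p1 /eqP p1E] := tied_p.
have /row_count_gt0_lt p2T : 0 < row_count T m p.2 by rewrite -p1E.
by rewrite /tau /transp; do 2?case: eqP => [->|_]; lia.
Qed.

Lemma row_count_transp r : row_count T m (tau r) = row_count T m r.
Proof.
have /and3P[_ _ /eqP p1E] := tied_p.
by rewrite /tau /transp; do 2?case: eqP => [->|_].
Qed.

Lemma nth_exchange r :
  nth [::] T' r =
  filter (leq^~ m) (nth [::] T r) ++ filter (ltn m) (nth [::] T (tau r)).
Proof.
have [rT|Tr] := ltnP r (size T); first by rewrite nth_mkseq.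
by rewrite !nth_default ?size_mkseq // leqNgt transp_lt_size -leqNgt.
Qed.

Lemma row_count_exchange_le m' r : m' <= m -> row_count T' m' r = row_count T m' r.
Proof.
move=> m'm; rewrite /row_count nth_exchange count_cat !count_filter.
rewrite [X in _ + X](_ : _ = 0) ?addn0.
  by apply: eq_count => x /=; apply: andb_idr => /leq_trans; apply.
apply/eqP; rewrite -leqn0 leqNgt -has_count; apply/hasPn => x _ /=.
by apply/negP; lia.
Qed.

Lemma row_count_split m' r : m <= m' ->
  row_count T m' r = row_count T m r + count (leq^~ m') (filter (ltn m) (nth [::] T r)).
Proof.
move=> mm'; have Tr := nth_row_sorted r (rows_sorted gT).
rewrite /row_count -{1}(filter_split_sorted m Tr).
rewrite count_cat; congr (_ + _); rewrite count_filter.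
by apply: eq_count => x /=; apply: andb_idl => /leq_trans; apply.
Qed.

(** With [row_count_exchange_le] this describes the growth of [T']: unchanged up to time [m],
    permuted by [tau] from then on. The two descriptions agree at [m] because of the tie. *)
Lemma row_count_exchange_ge m' r : m <= m' -> row_count T' m' r = row_count T m' (tau r).
Proof.
move=> mm'; rewrite (row_count_split _ mm') row_count_transp.
rewrite {1}/row_count nth_exchange count_cat count_filter; congr (_ + _).
by apply: eq_count => x /=; apply: andb_idl => /leq_trans; apply.
Qed.

Lemma perm_flatten_exchange : perm_eq (flatten T') (flatten T).
Proof.
apply/seq.permP => a; rewrite !count_flatten !sumnE !big_map.
pose F r := count a (filter (ltn m) (nth [::] T r)).
pose G r := count a (filter (leq^~ m) (nth [::] T r)).
have -> : \sum_(s <- T) count a s = \sum_(r <- iota 0 (size T)) (G r + F r).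
  rewrite (big_nth [::]) /index_iota subn0; apply: eq_bigr => r _.
  by rewrite -count_cat filter_split_sorted ?nth_row_sorted ?rows_sorted.
rewrite (eq_bigr (fun r => G r + F (tau r))) => [|r _]; last first.
  by rewrite -count_cat.
(* The heads stay in place, and the sum over the tails is reindexed by [tau], a bijection of the row
   indices. *)
rewrite !big_split /=; congr (_ + _); rewrite -(big_map tau xpredT F).
apply: perm_big; apply: uniq_perm; rewrite ?iota_uniq //.
  by rewrite map_inj_uniq ?iota_uniq //; apply: inv_inj (@transpK _ _).
move=> r; rewrite mem_iota /= add0n -transp_lt_size.
apply/mapP/idP => [[s + ->]|rT]; first by rewrite mem_iota /tau transpK.
by exists (tau r); rewrite ?mem_iota /tau ?transpK.
Qed.

Lemma sumn_shape_exchange : sumn (shape T') = sumn (shape T).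
Proof. by rewrite -!size_flatten (perm_size perm_flatten_exchange). Qed.

Lemma standard_exchange : standard T'.
Proof.
rewrite /standard sumn_shape_exchange.
exact: perm_trans perm_flatten_exchange (entries_standard gT).
Qed.

Lemma nth_shape_exchange r : m <= sumn (shape T) ->
  nth 0 (shape T') r = nth 0 (shape T) (tau r).
Proof.
move=> mT; rewrite -!row_count_size ?standard_exchange ?entries_standard //.
by rewrite sumn_shape_exchange row_count_exchange_ge.
Qed.

(** Only times from [m] on matter for [row_start]. By then all rows up to [p.2] have two boxes:
    those below [p.2] since row [p.2] is nonempty, and row [p.2] since it ties with the lower row
    [p.1]. Rows above [p.2] are fixed by [tau]. *)
Lemma peak_growth_exchange : m <= sumn (shape T) -> peak_growth T'.
Proof.
move=> mT; have /and3P[p12 p1 /eqP p1E] := tied_p; split.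
- apply/(all_nthP 0) => r; rewrite size_map size_mkseq nth_shape_exchange // => rT.
  by apply: (all_nthP 0 (rows_nonempty gT)); rewrite size_map transp_lt_size.
- apply/allP => s /(nthP [::])[r _ <-]; rewrite nth_exchange.
  have sorted_filter_row a s' : sorted ltn (filter a (nth [::] T s')).
    by apply: (sorted_filter ltn_trans); apply: nth_row_sorted (rows_sorted gT).
  rewrite sorted_pairwise; last exact: ltn_trans.
  rewrite pairwise_cat -!sorted_pairwise ?sorted_filter_row; try exact: ltn_trans.
  rewrite !andbT; apply/allrelP => x y; rewrite !mem_filter => /andP[xm _] /andP[my _].
  exact: leq_ltn_trans xm my.
- exact: standard_exchange.
have two r : r <= p.2 -> 1 < row_count T m r.
  rewrite leq_eqVlt => /orP[/eqP->|rp2]; last first.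
    by apply: row_start_lt rp2 _; rewrite -?p1E.
  by rewrite -p1E; apply: row_start_lt p12 _; rewrite -?p1E.
move=> m' r; have [mm'|/ltnW m'm] := leqP m m'; last first.
  by rewrite !row_count_exchange_le //; apply: row_start.
rewrite !row_count_exchange_ge // => r1.
have two_le s : s <= p.2 -> 1 < row_count T m' s.
  by move/two/leq_trans; apply; apply: row_count_mono.
have [rp2|p2r] := ltnP r p.2.
  by apply: two_le; rewrite /tau /transp; do 2?case: eqP => _; lia.
have tauS : tau r.+1 = r.+1 by rewrite /tau /transp; do 2?case: eqP => //; lia.
rewrite tauS in r1; have := row_start gT r1.
rewrite /tau /transp; case: eqP => [|_]; first by lia.
by case: eqP => // _ _; apply: two_le; lia.
Qed.

Lemma exchangeK : exchange T' m p = T.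
Proof.
apply: (@eq_from_nth _ [::]); rewrite !size_mkseq // => r rT.
rewrite nth_mkseq ?size_mkseq // !nth_exchange -/tau /tau transpK.
have filter_le a b :
    filter (leq^~ m) (filter (leq^~ m) a ++ filter (ltn m) b) = filter (leq^~ m) a.
  rewrite filter_cat filter_id (_ : filter _ (filter (ltn m) b) = [::]) ?cats0 //.
  rewrite -filter_predI (@eq_filter _ _ pred0) ?filter_pred0 // => x /=.
  by apply/negbTE/negP; lia.
have filter_gt a b :
    filter (ltn m) (filter (leq^~ m) a ++ filter (ltn m) b) = filter (ltn m) b.
  rewrite filter_cat filter_id (_ : filter _ (filter (leq^~ m) a) = [::]) //.
  rewrite -filter_predI (@eq_filter _ _ pred0) ?filter_pred0 // => x /=.
  by apply/negbTE/negP; lia.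
by rewrite filter_le filter_gt filter_split_sorted ?nth_row_sorted ?rows_sorted.
Qed.

(** Follows a single entry through the exchange: its column is kept, and its row can change only if
    the entry exceeds [m]. *)
Lemma exchange_box i r : m <= sumn (shape T) -> (i, r.+1) \in diagram (shape T) ->
  let r' := if entry T i r.+1 <= m then r else tau r in
  (i, r'.+1) \in diagram (shape T') /\ entry T' i r'.+1 = entry T i r.+1.
Proof.
move=> mT iT; have Ts := rows_sorted gT.
have i0 : 0 < i by move: iT; rewrite mem_diagram => /and3P[].
rewrite /= -row_countP //; case: leqP => im.
  split; first by apply: (row_countW (m := m)); rewrite ?row_count_exchange_le.
  rewrite /entry /= nth_exchange -{2}(filter_split_sorted m (nth_row_sorted r Ts)).
  by rewrite !nth_cat size_filter -/(row_count T m r) prednK // im.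
split.
  by move: iT; rewrite !mem_diagram /= nth_shape_exchange // /tau transpK.
rewrite /entry /= nth_exchange -(filter_split_sorted m (nth_row_sorted r Ts)).
rewrite !nth_cat !size_filter -!/(row_count T m _) row_count_transp prednK //.
by rewrite leqNgt im /tau transpK.
Qed.

End Exchange.

(** * The last tie *)

Definition row_pairs (T : tableau) : seq (nat * nat) :=
  [seq (i, j) | i <- iota 0 (size T), j <- iota 0 (size T)].

Definition tie (T : tableau) (m : nat) : bool := has (tied T m) (row_pairs T).

(** The choice of the first tied pair depends only on the number of rows and the row counts at time
    [m], so the same pair is found again after the exchange; this makes [switch] an involution. *)
Definition tie_pair (T : tableau) (m : nat) : nat * nat :=
  nth (0, 0) (row_pairs T) (find (tied T m) (row_pairs T)).

Definition has_tie (T : tableau) : bool := has (tie T) (iota 0 (sumn (shape T)).+1).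

Definition last_tie (T : tableau) : nat := \max_(m < (sumn (shape T)).+1 | tie T m) m.

Definition switch (T : tableau) : tableau :=
  exchange T (last_tie T) (tie_pair T (last_tie T)).

Lemma tieP T m : reflect (exists p, tied T m p) (tie T m).
Proof.
apply: (iffP hasP) => [[p _ pT]|[[i j] ijT]]; first by exists p.
have /and3P[/= _ i0 /eqP ij] := ijT; exists (i, j) => //.
by apply: allpairs_f; rewrite mem_iota /= (@row_count_gt0_lt T m) -?ij.
Qed.

Lemma tie_neq T m i j : i != j -> 0 < row_count T m i ->
  row_count T m i = row_count T m j -> tie T m.
Proof.
move=> ij i0 ijE; apply/tieP; case: (ltngtP i j) ij => // [ij|ji] _.
  by exists (i, j); rewrite /tied /= ij i0 ijE eqxx.
by exists (j, i); rewrite /tied /= ji -ijE i0 eqxx.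
Qed.

Lemma tied_tie_pair T m : tie T m -> tied T m (tie_pair T m).
Proof. exact: nth_find. Qed.

Lemma last_tieP T : has_tie T ->
  [/\ last_tie T <= sumn (shape T), tie T (last_tie T) &
      forall m, last_tie T < m <= sumn (shape T) -> ~~ tie T m].
Proof.
case/hasP=> m0; rewrite mem_iota /= add0n => m0T m0_tie.
pose P := [pred m : 'I_(sumn (shape T)).+1 | tie T m].
have P0 : P (Ordinal m0T) by [].
rewrite /last_tie (bigmax_eq_arg (P := P) _ P0) -/P.
case: arg_maxnP => // k k_tie k_max; split=> //; first by rewrite -ltnS.
move=> m /andP[km mT]; apply: contraTN km => m_tie; rewrite -leqNgt.
exact: (k_max (Ordinal (mT : m < (sumn (shape T)).+1))).
Qed.

Lemma last_tie_eq T k : k <= sumn (shape T) -> tie T k ->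
  (forall m, k < m <= sumn (shape T) -> ~~ tie T m) -> has_tie T /\ last_tie T = k.
Proof.
move=> kT k_tie k_max; have T_tie : has_tie T.
  by apply/hasP; exists k => //; rewrite mem_iota /= add0n ltnS.
split=> //; have [lT l_tie l_max] := last_tieP T_tie.
case: (ltngtP (last_tie T) k) => // [lk|kl].
  by have := l_max k; rewrite lk kT k_tie => /(_ isT).
by have := k_max (last_tie T); rewrite kl lT l_tie => /(_ isT).
Qed.

Section Switch.

Variable T : tableau.
Hypotheses (gT : peak_growth T) (T_tie : has_tie T).

Let k := last_tie T.
Let p := tie_pair T k.
Let tau := transp p.1 p.2.

Let kT : k <= sumn (shape T). Proof. by case: (last_tieP T_tie). Qed.

Let tied_p : tied T k p.
Proof. by apply: tied_tie_pair; case: (last_tieP T_tie). Qed.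

Lemma peak_growth_switch : peak_growth (switch T).
Proof. exact: peak_growth_exchange. Qed.

Lemma sumn_shape_switch : sumn (shape (switch T)) = sumn (shape T).
Proof. exact: sumn_shape_exchange. Qed.

Lemma nth_shape_switch r : nth 0 (shape (switch T)) r = nth 0 (shape T) (tau r).
Proof. exact: nth_shape_exchange. Qed.

Lemma tied_switch : tied (switch T) k =1 tied T k.
Proof. by move=> q; rewrite /tied !row_count_exchange_le. Qed.

(** From time [k] on the row counts are merely permuted by [tau], so no new tie appears. As [tau]
    may reverse the order of the two rows, the symmetric [tie_neq] is used. *)
Lemma tie_switch m : k <= m -> tie (switch T) m -> tie T m.
Proof.
move=> km /tieP[[i j]]; rewrite /tied !row_count_exchange_ge //=.
case/and3P=> ij i0 /eqP ijE; apply: tie_neq i0 ijE.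
by rewrite (inj_eq (inv_inj (@transpK _ _))); rewrite neq_ltn ij.
Qed.

Lemma last_tie_switch : has_tie (switch T) /\ last_tie (switch T) = k.
Proof.
apply: last_tie_eq; first by rewrite sumn_shape_switch.
  by apply/tieP; exists p; rewrite tied_switch.
move=> m; rewrite sumn_shape_switch => /andP[km mT].
apply: contra (tie_switch (ltnW km)) _.
by case: (last_tieP T_tie) => _ _; apply; rewrite km.
Qed.

Lemma switchK : switch (switch T) = T.
Proof.
have [_ kE] := last_tie_switch.
rewrite [switch (switch T)]/switch kE.
have -> : tie_pair (switch T) k = p.
  rewrite /tie_pair /row_pairs size_mkseq.
  by rewrite (eq_find tied_switch).
exact: exchangeK.
Qed.

End Switch.

Lemma entry_lt T i r : all (sorted ltn) T -> 0 < i ->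
  (i.+1, r.+1) \in diagram (shape T) ->
  entry T i r.+1 < entry T i.+1 r.+1.
Proof.
case: i => // i Ts _; rewrite mem_diagram nth_shape /= => ir.
by have /(sortedP 0)/(_ i ir) := nth_row_sorted r Ts.
Qed.

(** Let [x] and [x.+1] be the entries of [b] and [b'], in column [i]. At time [x.+1] the row of [b']
    has just reached [i] boxes; the row of [b] reached [i] at time [x] and cannot have grown since,
    because [x.+1] went elsewhere. *)
Lemma consecutive_same_col_tie T b b' : peak_growth T ->
  b \in diagram (shape T) -> b' \in diagram (shape T) -> b.1 = b'.1 ->
  entry T b'.1 b'.2 = (entry T b.1 b.2).+1 -> tie T (entry T b'.1 b'.2).
Proof.
case: b b' => [i [|r]] [i' [|r']] gT; rewrite ?[(_, 0) \in _]mem_diagram //=.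
move=> bT b'T; move: b'T => /[swap] <- b'T bb'; have [_ Ts pT _] := gT.
have i0 : 0 < i by move: bT; rewrite mem_diagram => /and3P[].
have rr' : r != r' by apply/eqP=> rr'; move: bb'; rewrite rr'; lia.
have count_b : row_count T (entry T i r'.+1) r = i.
  apply/eqP; rewrite eqn_leq row_countP // bb' leqnSn andbT leqNgt; apply/negP=> ir.
  have cT := row_countW (ltn0Sn i) ir.
  have := entry_lt Ts i0 cT; move: ir; rewrite row_countP // => ir ir'.
  have e : entry T i.+1 r.+1 = entry T i r'.+1 by lia.
  by have [] := entry_inj pT cT b'T e; lia.
have count_b' : row_count T (entry T i r'.+1) r' = i.
  apply/eqP; rewrite eqn_leq row_countP // leqnn andbT leqNgt; apply/negP=> ir.
  have cT := row_countW (ltn0Sn i) ir.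
  by have := entry_lt Ts i0 cT; move: ir; rewrite row_countP //; lia.
by apply: (tie_neq rr'); rewrite count_b ?count_b'.
Qed.

(** Columns are kept, so the order of [x] and [x.+1] could change only within one column. They then
    create a tie at [x.+1], which is at most the last tie, so neither entry moves. *)
Lemma Des_switch T : peak_growth T -> has_tie T ->
  Des (word_c (switch T)) = Des (word_c T).
Proof.
move=> gT T_tie; have [kT k_tie k_max] := last_tieP T_tie.
have tied_p := tied_tie_pair k_tie; have pT := entries_standard gT.
rewrite /Des !size_word_c sumn_shape_switch //; apply: eq_in_filter => x.
rewrite mem_iota => x_range.
have [|[i [|r]] bT bx] := entry_box (x := x) pT; first by lia.
  by rewrite mem_diagram in bT.
have [|[i' [|r']] b'T bx'] := entry_box (x := x.+1) pT; first by lia.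
  by rewrite mem_diagram in b'T.
rewrite /= in bx bx'.
have [cT] := exchange_box gT tied_p kT bT; have [c'T] := exchange_box gT tied_p kT b'T.
move=> cx' cx; have := index_word_c (standard_exchange gT tied_p) c'T cT.
rewrite /= cx cx' bx bx' /switch => ->.
have := index_word_c pT b'T bT; rewrite /= bx bx' => ->.
rewrite /col_lt /=; case: (ltngtP i' i) => //= ii'.
have := consecutive_same_col_tie gT bT b'T (esym ii').
rewrite /= bx bx' => /(_ erefl) x_tie.
have xk : x < last_tie T.
  rewrite ltnNge; apply/negP=> kx; have := k_max x.+1.
  have xT : x < sumn (shape T) by move: x_range; lia.
  by rewrite ltnS kx xT x_tie => /(_ isT).
by rewrite xk (ltnW xk).
Qed.

(** * Tableaux without ties *)

Lemma row_count_entry T i r : all (sorted ltn) T -> (i, r.+1) \in diagram (shape T) ->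
  row_count T (entry T i r.+1) r = i.
Proof.
move=> Ts iT; have i0 : 0 < i by move: iT; rewrite mem_diagram => /and3P[].
apply/eqP; rewrite eqn_leq row_countP // leqnn andbT leqNgt; apply/negP=> ir.
have cT := row_countW (ltn0Sn i) ir.
by have := entry_lt Ts i0 cT; move: ir; rewrite row_countP //; lia.
Qed.

(** Induction on the column: the lower row [i] starts with a lead of one box by [row_start_lt]. If
    row [j] caught up on receiving a box, the two counts would be equal and positive, which is a
    tie. *)
Lemma no_tie_dominance T c i j : peak_growth T -> ~~ has_tie T -> i < j ->
  (c, j.+1) \in diagram (shape T) -> c < row_count T (entry T c j.+1) i.
Proof.
move=> gT no_tie ij; have [_ Ts pT _] := gT.
elim: c => [|c IHc] cT; first by rewrite mem_diagram in cT.
have [->|c0] := posnP c.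
  apply: row_start_lt ij _ => //; rewrite row_countP //.
  by move: cT; rewrite !mem_diagram; lia.
have c'T : (c, j.+1) \in diagram (shape T) by move: cT; rewrite !mem_diagram; lia.
have cc' := ltnW (entry_lt Ts c0 cT).
have := leq_trans (IHc c'T) (row_count_mono T i cc').
rewrite leq_eqVlt => /orP[/eqP ciE|//].
have /negP[] := no_tie; apply/hasP; exists (entry T c.+1 j.+1).
  by have := entry_range pT cT; rewrite mem_iota /=; lia.
by apply: (@tie_neq _ _ i j); rewrite ?row_count_entry ?ltn_eqF // -ciE.
Qed.

(** Dominance at the last box of the upper row. *)
Lemma no_tie_shape_sorted T : peak_growth T -> ~~ has_tie T -> sorted gtn (shape T).
Proof.
move=> gT no_tie; have [T1 _ _ _] := gT; apply/(sortedP 0) => r rT /=.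
have cT : (nth 0 (shape T) r.+1, r.+2) \in diagram (shape T).
  by rewrite mem_diagram /= leqnn andbT; apply: (all_nthP 0 T1).
exact: leq_trans (no_tie_dominance gT no_tie (ltnSn r) cT) (row_count_le_size _ _ _).
Qed.

Lemma young_tripleP T :
  reflect (forall i j k, i < j -> (k, j) \in diagram (shape T) ->
             (k.+1, i) \in diagram (shape T) -> entry T k j <= entry T k.+1 i ->
             (k.+1, j) \in diagram (shape T) /\ entry T k.+1 j < entry T k.+1 i)
          (young_triple T).
Proof.
apply: (iffP forallP) => [yT i j k ij kj ki kji|yT i]; last first.
  apply/forallP=> j; apply/forallP=> k; apply/implyP=> /and4P[ij kj ki kji].
  by apply/andP; apply: yT.
have jT : j < (size T).+1.
  move: kj; rewrite mem_diagram ltnS; case: (leqP j (size T)) => // Tj.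
  by rewrite nth_default ?size_map; lia.
have kT : k < (sumn (shape T)).+1.
  move: kj; rewrite mem_diagram ltnS; case: (ltnP j.-1 (size (shape T))) => j1.
    by case/and3P=> _ _ /leq_trans-> //; rewrite mem_sumn_leq ?mem_nth.
  by rewrite nth_default //; lia.
have := yT (Ordinal (ltn_trans ij jT)).
move=> /forallP/(_ (Ordinal jT))/forallP/(_ (Ordinal kT))/implyP/=.
by rewrite ij kj ki kji => /(_ isT)/andP.
Qed.

(** Without ties, dominance contradicts the premise of every triple. Conversely, a tie at [m] with
    count [d] puts entry [d] of the upper row before entry [d.+1] of the lower one, and the triple
    condition carries this relation from column to column until the upper, shorter row ends. *)
Lemma young_triple_no_tie T : peak_growth T -> sorted gtn (shape T) ->
  young_triple T = ~~ has_tie T.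
Proof.
move=> gT shT; have [_ Ts pT _] := gT; apply/young_tripleP/idP => [yT|no_tie]; last first.
  move=> i [|j] k ij; first by [].
  case: i ij => [|i]; first by rewrite (mem_diagram _ k.+1).
  rewrite ltnS => ij kj ki kji; have := no_tie_dominance gT no_tie ij kj.
  rewrite row_countP // => kij; have e : entry T k.+1 i.+1 = entry T k j.+1 by lia.
  by have [] := entry_inj pT ki kj e; lia.
apply/hasPn => m _; apply/tieP => -[[i j] /and3P[/= ij i0 /eqP ijE]].
have shij : nth 0 (shape T) j < nth 0 (shape T) i.
  have jT : j < size T by apply: (@row_count_gt0_lt T m); rewrite -ijE.
  apply: (sorted_ltn_nth (leT := gtn)) => //; rewrite ?inE ?size_map //; last first.
    exact: ltn_trans jT.
  by move=> ? ? ? /= h1 h2; apply: ltn_trans h2 h1.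
(* Induction on the number of boxes to the right of column [d] in the upper row. The triple
   condition supplies box [d.+1] there, and the longer lower row then has a box in column [d.+2]. *)
have no_cross d : (d, j.+1) \in diagram (shape T) ->
    entry T d j.+1 <= entry T d.+1 i.+1 -> False.
  have [e] := ubnP (nth 0 (shape T) j - d); elim: e d => // e IHe d de dj dij.
  have di : (d.+1, i.+1) \in diagram (shape T) by move: dj; rewrite !mem_diagram /=; lia.
  have [d'j d'ij] := yT _ _ _ (ij : i.+1 < j.+1) dj di dij.
  have d'i : (d.+2, i.+1) \in diagram (shape T) by move: d'j; rewrite !mem_diagram /=; lia.
  apply: (IHe d.+1) => //; first by move: d'j; rewrite !mem_diagram /=; lia.
  by apply: ltnW; apply: ltn_trans d'ij (entry_lt Ts _ d'i).
have cj : (row_count T m i, j.+1) \in diagram (shape T).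
  by apply: (row_countW (m := m)); rewrite -?ijE.
have ci : ((row_count T m i).+1, i.+1) \in diagram (shape T).
  by move: cj; rewrite !mem_diagram /=; lia.
apply: (no_cross _ cj).
have : entry T (row_count T m i) j.+1 <= m by rewrite -row_countP // ijE.
have : ~~ (entry T (row_count T m i).+1 i.+1 <= m) by rewrite -row_countP // ltnn.
by lia.
Qed.

(** * The sign of the sorting permutation *)

Section Ascents.

Local Open Scope ring_scope.

(** For distinct parts these are the inversions of the sorting permutation, as sorting is
    decreasing; the count is free of the type ['S_(size c)], which varies with [c]. *)
Definition ascents (n : nat) (f : nat -> nat) : nat :=
  #|[set p : 'I_n * 'I_n | (p.1 < p.2)%N && (f p.1 < f p.2)%N]|.

(* The Vandermonde determinant of the numbers -(f i) is the product of the
   f i - f j over i < j. *)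
Lemma sign_ascents (n : nat) (f : nat -> nat) : {in gtn n &, injective f} ->
  (-1) ^+ ascents n f =
  Num.sg (\det (Vandermonde n (\row_(i < n) - (f i)%:Z))).
Proof.
move=> f_inj; rewrite det_Vandermonde.
rewrite (big_morph Num.sg (@sgrM _) (@sgr1 _)).
under eq_bigr => i _ do rewrite (big_morph Num.sg (@sgrM _) (@sgr1 _)).
rewrite pair_big_dep /= (eq_bigr (fun p : 'I_n * 'I_n =>
  if (f p.1 < f p.2)%N then -1 else 1)) => [|[i j] /= ij].
  rewrite -big_mkcondr prodr_const; congr (_ ^+ _).
  by apply: eq_card => p; rewrite inE.
rewrite !mxE opprK addrC; case: ltngtP => [fij|fji|/f_inj fij].
- by rewrite ltr0_sg // subr_lt0 ltz_nat.
- by rewrite gtr0_sg // subr_gt0 ltz_nat.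
by move: ij; rewrite fij ?inE ?ltnn.
Qed.

(** Exchanging two values of [f], adjacent or not, swaps two columns of the Vandermonde matrix, so
    its determinant changes sign. *)
Lemma sign_ascents_transp (n i j : nat) (f : nat -> nat) :
  {in gtn n &, injective f} -> (i < j < n)%N ->
  (-1) ^+ ascents n (f \o transp i j) = - (-1) ^+ ascents n f :> int.
Proof.
move=> f_inj /andP[ij jn]; have i_n := ltn_trans ij jn.
have transp_lt r : (r < n)%N -> (transp i j r < n)%N.
  by rewrite /transp; do 2?case: eqP.
rewrite !sign_ascents //; last first.
  move=> a b an bn /= /f_inj; rewrite !inE => /(_ (transp_lt _ an) (transp_lt _ bn)).
  exact: (inv_inj (@transpK i j)).
set s := tperm (Ordinal i_n) (Ordinal jn).
have -> : Vandermonde n (\row_(r < n) - ((f \o transp i j) r)%:Z) =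
          col_perm s (Vandermonde n (\row_(r < n) - (f r)%:Z)).
  apply/matrixP => a b; rewrite !mxE /=; congr ((- (f _)%:Z) ^+ _).
  by rewrite /s permE /transp /= -!val_eqE /=; do 2?case: eqP.
rewrite col_permE det_mulmx det_perm sgrM odd_permV odd_tperm.
by rewrite -val_eqE /= ltn_eqF // expr1 sgrN1 mulrN1.
Qed.

End Ascents.

(** The sorted list is strictly decreasing, so two positions are inverted by the sorting permutation
    exactly when the earlier part is the smaller one. *)
Lemma perm_length_sort_perm (c : seq nat) : uniq c ->
  perm_length (sort_perm c) = ascents (size c) (nth 0 c).
Proof.
move=> c_uniq; have [sc _] := sort_permP c; set s := sort_perm c in sc *.
have nth_s i : nth 0 (part_of c) (s i) = nth 0 c i.
  rewrite -sc /act_comp (nth_map i) ?size_enum_ord ?ltn_ord // nth_ord_enum.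
  by rewrite permK.
have sz : size (part_of c) = size c by rewrite size_sort.
have geq_total : total geq by move=> x y /=; apply: leq_total.
have sorted_c : sorted gtn (part_of c).
  by rewrite gtn_sorted_uniq_geq sort_uniq c_uniq sort_sorted.
have gtn_tr : transitive gtn by move=> y x z /= xy yz; apply: ltn_trans yz xy.
apply: eq_card => -[i j]; rewrite !inE /=; congr (_ && _).
rewrite -!nth_s; have lt_nth := sorted_ltn_nth gtn_tr 0 sorted_c.
have in_sz (k : 'I_(size c)) : nat_of_ord k \in [pred n | n < size (part_of c)].
  by rewrite inE sz.
case: (ltngtP (s j) (s i)) => [ji|ij|ij].
- by apply/esym; exact: (lt_nth _ _ (in_sz _) (in_sz _) ji).
- apply/esym/negbTE; rewrite -leqNgt ltnW //.
  exact: (lt_nth _ _ (in_sz _) (in_sz _) ij).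
- by rewrite (val_inj ij) ltnn.
Qed.

Definition sort_sign (c : seq nat) : int := ((-1) ^+ perm_length (sort_perm c))%R.

Lemma sort_sign_sorted c : sorted gtn c -> sort_sign c = 1%R.
Proof.
move=> c_sorted; have := c_sorted; rewrite gtn_sorted_uniq_geq => /andP[c_uniq _].
rewrite /sort_sign perm_length_sort_perm // /ascents (_ : [set _ | _] = set0) ?cards0 //.
apply/setP => -[i j]; rewrite !inE /=; apply/negP => /andP[ij]; apply/negP.
rewrite -leqNgt ltnW //; apply: (sorted_ltn_nth (leT := gtn)); rewrite ?inE //.
by move=> y x z /= xy yz; apply: ltn_trans yz xy.
Qed.

Lemma sort_sign_transp c c' i j : uniq c -> size c' = size c -> i < j < size c ->
  nth 0 c' =1 nth 0 c \o transp i j -> perm_eq c' c /\ sort_sign c' = (- sort_sign c)%R.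
Proof.
move=> c_uniq sz ij c'E.
have transp_lt r : r < size c -> transp i j r < size c.
  by rewrite /transp; do 2?case: eqP; lia.
have nth_inj : {in gtn (size c) &, injective (nth 0 c)}.
  by move=> a b ac bc /eqP; rewrite nth_uniq // => /eqP.
have c'_uniq : uniq c'.
  apply/(uniqP 0) => a b; rewrite !inE sz !c'E /= => ac bc /nth_inj.
  rewrite !inE !transp_lt // => /(_ isT isT).
  exact: (inv_inj (@transpK i j)).
split.
  have c'_sub : {subset c' <= c}.
    by move=> x /(nthP 0)[r]; rewrite sz c'E => /transp_lt rc <-; rewrite mem_nth.
  have [_ c'_c] := uniq_min_size c'_uniq c'_sub (eq_leq (esym sz)).
  exact: uniq_perm.
rewrite /sort_sign !perm_length_sort_perm // sz.
rewrite -(sign_ascents_transp nth_inj ij).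
by congr (_ ^+ _)%R; apply: eq_card => p; rewrite !inE !c'E.
Qed.

(** * The sign-reversing involution *)

Lemma part_of_sorted lam : sorted gtn lam -> part_of lam = lam.
Proof.
rewrite gtn_sorted_uniq_geq => /andP[_ lam_geq]; apply: sorted_sort => //.
by move=> y x z /= xy yz; apply: leq_trans yz xy.
Qed.

Lemma strict_partition_is_peak lam : strict_partition lam -> is_peak lam.
Proof.
case/andP=> lam1 lam_gtn; rewrite /is_peak lam1; apply/(all_nthP 0) => r.
rewrite size_take_min => rl; rewrite nth_take; last by lia.
have rl' : r.+1 < size lam by lia.
have /(sortedP 0)/(_ r rl') := lam_gtn.
by apply: leq_ltn_trans; apply: (all_nthP 0 lam1).
Qed.

Lemma mem_SPYCT lam T : strict_partition lam ->
  reflect [/\ shape T = lam, peak_growth T & ~~ has_tie T] (T \in SPYCT lam).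
Proof.
move=> lam_strict; have lam_peak := strict_partition_is_peak lam_strict.
have /andP[_ lam_gtn] := lam_strict.
have -> : (T \in SPYCT lam) = (T \in SPIT lam) && young_triple T.
  rewrite !mem_filter; case: (peak_tableau T); case: (young_triple T);
    by rewrite ?(andbT, andbF).
apply: (iffP andP) => [[/(SPITP _ lam_peak)[shT gT] yT]|[shT gT no_tie]].
  by split=> //; rewrite -young_triple_no_tie // shT.
split; first by apply/SPITP.
by rewrite young_triple_no_tie // shT.
Qed.

Definition rearrangements (lam : seq nat) : {pred composition (sumn lam)} :=
  [pred a : composition (sumn lam) | is_peak a && (part_of a == lam)].

Definition rearranged_SPIT (lam : seq nat) : seq tableau :=
  flatten [seq SPIT (val a) | a <- enum (@rearrangements lam)].

(** Peak growth already forces the shape to be a peak composition, so the union is cut out by the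
    sorted parts alone, a condition that [switch] preserves. *)
Lemma mem_rearranged_SPIT lam T :
  reflect (peak_growth T /\ part_of (shape T) = lam) (T \in rearranged_SPIT lam).
Proof.
apply: (iffP flatten_mapP) => [[a]|[gT shT]].
  by rewrite mem_enum => /andP[a_peak /eqP aE] /(SPITP _ a_peak)[-> gT].
have sh_peak := peak_growth_is_peak gT.
have shP : is_comp (sumn lam) (shape T).
  rewrite /is_comp rows_nonempty // -shT; apply/eqP/perm_sumn.
  by rewrite perm_sym; apply/permPl/perm_sort.
exists (Composition shP); last exact: peak_growth_SPIT.
by rewrite mem_enum unfold_in /= sh_peak shT eqxx.
Qed.

Lemma rearranged_SPIT_uniq lam : uniq (rearranged_SPIT lam).
Proof.
rewrite /rearranged_SPIT; have := enum_uniq (@rearrangements lam).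
have shapeP a T : T \in SPIT a -> shape T = a.
  by rewrite mem_filter mem_fillings => /and3P[_ /eqP].
elim: (enum _) => //= a s IHs /andP[a_s /IHs s_uniq]; rewrite cat_uniq s_uniq.
rewrite filter_uniq ?fillings_uniq // andbT; apply/hasPn => T.
case/flatten_mapP=> b bs /shapeP Tb; apply/negP => /shapeP Ta.
by move: a_s; rewrite (_ : a = b) ?bs //; apply: val_inj; rewrite /= -Ta.
Qed.

Theorem proposition4p6 (lam : seq nat) (lam_strict : strict_partition lam)
    (m : monomial) :
  peak_young_quasisym_schur lam m =
  (\sum_(a : composition (sumn lam) | is_peak a && (part_of a == lam))
     (-1) ^+ perm_length (sort_perm a) * quasisym_schurQ a m)%R.
Proof.
have /andP[_ lam_gtn] := lam_strict.
have lam_uniq : uniq lam by move: lam_gtn; rewrite gtn_sorted_uniq_geq => /andP[].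
pose weight T := peak_K (comp_of (sumn (shape T)) (Peak (Des (word_c T)))) m.
pose term T := (sort_sign (shape T) * weight T)%R.
(* The double sum on the right becomes a single signed sum over tableaux, the sign depending only on
   the shape. *)
transitivity (\sum_(T <- rearranged_SPIT lam) term T)%R; last first.
  rewrite big_flatten big_map big_enum; apply: eq_bigr => a /andP[a_peak _].
  rewrite /quasisym_schurQ big_distrr; apply: eq_big_seq => T.
  by case/(SPITP _ a_peak)=> shT _; rewrite /term /weight shT.
rewrite (bigID has_tie) /= [X in (_ = X + _)%R](_ : _ = 0%R) ?add0r.
  rewrite -big_filter.
  (* A tableau without ties has decreasing shape, hence shape [lam] and sign 1. *)
  have no_tie_SPYCT : perm_eq [seq T <- rearranged_SPIT lam | ~~ has_tie T] (SPYCT lam).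
    apply: uniq_perm; rewrite ?filter_uniq ?rearranged_SPIT_uniq ?fillings_uniq // => T.
    rewrite mem_filter; apply/andP/mem_SPYCT => // [[no_tie]|[shT gT no_tie]].
      case/mem_rearranged_SPIT=> gT <-; split=> //.
      by rewrite part_of_sorted // no_tie_shape_sorted.
    by split=> //; apply/mem_rearranged_SPIT; rewrite shT part_of_sorted.
  rewrite (perm_big _ no_tie_SPYCT).
  apply: eq_big_seq => T /(mem_SPYCT _ lam_strict)[shT gT _].
  by rewrite /term /weight shT sort_sign_sorted // mul1r Des_word_Y.
set X := [seq T <- rearranged_SPIT lam | has_tie T].
have XP T : T \in X ->
  [/\ has_tie T, peak_growth T, part_of (shape T) = lam & uniq (shape T)].
  rewrite mem_filter => /andP[T_tie /mem_rearranged_SPIT[gT shT]]; split=> //.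
  by rewrite -(sort_uniq geq) [sort _ _]shT.
have switch_term T : T \in X ->
    part_of (shape (switch T)) = lam /\ term (switch T) = (- term T)%R.
  case/XP=> T_tie gT shT sh_uniq; have [kT k_tie _] := last_tieP T_tie.
  have tied_p := tied_tie_pair k_tie; have /and3P[p12 p1 /eqP p1E] := tied_p.
  have sz : size (shape (switch T)) = size (shape T).
    by rewrite !size_map size_iota.
  have p_lt : (tie_pair T (last_tie T)).1 < (tie_pair T (last_tie T)).2 < size (shape T).
    by rewrite p12 size_map (row_count_gt0_lt (m := last_tie T)) // -p1E.
  (* The parts of the shape are distinct because [lam] is strict, so transposing the two tied rows
     reverses the sign. *)
  have [sh'_perm sign'] :=
    sort_sign_transp sh_uniq sz p_lt (nth_shape_switch gT T_tie).
  split; last by rewrite /term /weight sign' sumn_shape_switch // Des_switch // mulNr.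
  rewrite -shT; apply/perm_sortP => //; first by move=> x y; apply: leq_total.
    by move=> y x z /= xy yz; apply: leq_trans yz xy.
  by move=> x y; rewrite /= andbC => /anti_leq.
have X_uniq : uniq X by rewrite filter_uniq ?rearranged_SPIT_uniq.
have switch_X T : T \in X -> switch T \in X.
  move=> TX; have [T_tie gT _ _] := XP T TX; have [shT' _] := switch_term T TX.
  rewrite mem_filter; have [-> _] := last_tie_switch gT T_tie.
  by apply/mem_rearranged_SPIT; split=> //; apply: peak_growth_switch.
have switchKX T : T \in X -> switch (switch T) = T.
  by case/XP=> T_tie gT _ _; apply: switchK.
have perm_X : perm_eq (map switch X) X.
  apply: uniq_perm => // [|T].
    rewrite map_inj_in_uniq // => T1 T2 T1X T2X e.
    by rewrite -(switchKX T1) // e switchKX.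
  apply/mapP/idP => [[S SX ->]|TX]; first exact: switch_X.
  by exists (switch T); rewrite ?switchKX ?switch_X.
(* Reindexing along [switch] equates the sum over [X] with its own opposite, and an integer equal to
   its opposite is 0. *)
apply/eqP; rewrite -big_filter -/X -eqNr -sumrN -[X in _ == X](perm_big _ perm_X) big_map.
by apply/eqP/eq_big_seq => T /switch_term[_ ->].
Qed.
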